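(* Let $\psi\colon D^2\to D^2$ be an area-preserving diffeomorphism generated by a $2\pi$-periodic Hamiltonian function $H_s$ with $H_s|_{\partial D^2}\equiv h\in\mathbb{N}$ for all $s\in S^1=\mathbb{R}/2\pi\mathbb{Z}$. Assume that $\psi$ embeds into a Reeb flow on $S^3$ by the cut construction, starting from the contact form $\alpha=H_s\,\mathrm{d}s+\lambda$ on $S^1\times D^2$. Let $\varphi\colon D^2\to D^2$ be a further area-preserving diffeomorphism. Then the conjugate $\varphi^{-1}\circ\psi\circ\varphi$ likewise embeds into a Reeb flow on $S^3$.
   Context: $D^2$ is the closed unit disc with polar coordinates $(r,\theta)$, area form $\omega=2r\,\mathrm{d}r\wedge\mathrm{d}\theta$, and primitive $\lambda=r^2\,\mathrm{d}\theta$. ''Generated by $H_s$'' means that $\psi$ is the time-$2\pi$ map of the isotopy generated by $X_s$, where $\omega(X_s,\cdot)=\mathrm{d}H_s$. $\mathbb{N}$ denotes the positive integers. Cut construction starting from $\alpha$: $\alpha=H_s\,\mathrm{d}s+\lambda$ is assumed to be a contact form on $V=S^1\times D^2$. Let $V/\!\sim$ be the quotient obtained by collapsing the orbits of the $S^1$-action on $\partial V$ generated by $Y=\partial_s-h\partial_\theta$; it is a copy of $S^3$. Let $B:=(\partial V)/S^1\cong\partial D^2$, with coordinate $b$. Choose a collar parameter $\tau=\tau(r,s,\theta)$ near $\partial V$ (smooth, $\tau=0$ exactly on $\partial V$, $\tau<0$ in the interior, with $r=g(\tau,s,\theta)$ for a smooth function $g$; for instance $\tau=r-1$). The smooth structure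 near $B$ is defined by the map $$\Phi\colon B\times\bigl(\mathrm{Int}(D^2_{\sqrt\varepsilon})\setminus\{0\}\bigr)\to\mathrm{Int}(V),\quad (b;\rho,\vartheta)\mapsto\bigl(s=\vartheta;\ r=g(-\rho^2,\vartheta,b-h\vartheta),\ \theta=b-h\vartheta\bigr),$$ extended over $\rho=0$ by identifying $B\times\{0\}$ with $B\subset V/\!\sim$. ''$\psi$ embeds into a Reeb flow on $S^3$ by the cut construction, starting from $\alpha$'' means that $\Phi^*\alpha$ extends smoothly as a contact form over $B\times\{0\}$, so that $\alpha$ on $\mathrm{Int}(V)$ extends to a contact form on $S^3=V/\!\sim$, and the image of $\{0\}\times D^2$ is a global surface of section of its Reeb flow with return map $\psi|_{\mathrm{Int}(D^2)}$. Global surface of section for the flow of a non-singular vector field $X$ on a closed $3$-manifold $M$: an embedded compact surface $\Sigma\subset M$ such that each component of $\partial\Sigma$ is a periodic orbit of $X$, $\mathrm{Int}(\Sigma)$ is transverse to $X$, and the orbit through any point of $M\setminus\partial\Sigma$ meets $\mathrm{Int}(\Sigma)$ in forward and backward time. An area-preserving diffeomorphism $\psi\colon\Sigma\to\Sigma$ ''embeds into a Reeb flow on $M$'' if it can be realised, on $\mathrm{Int}(\Sigma)$, as the first-return map on a global surface of section for the Reeb flow of some contact form on $M$, where the identification of $\Sigma$ with the surface of section is a topological embedding $\Sigma\hookrightarrow M$, smooth as an embedding on $\mathrm{Int}(\Sigma)$, whose image is a smoothly embedded surface with boundary. *)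

(* Defs.v *)
From HB Require Import structures.
From mathcomp Require Import all_boot all_order all_algebra.
From mathcomp Require Import all_classical all_reals all_analysis.

Set Implicit Arguments.
Unset Strict Implicit.
Unset Printing Implicit Defensive.

Import Order.TTheory GRing.Theory Num.Theory.
Import numFieldNormedType.Exports.

Local Open Scope classical_set_scope.
Local Open Scope ring_scope.

(* Conventions.
   - R^n is 'rV[R]_n; its library norm is the sup norm, so round discs and
     spheres are defined through the dot product.
   - A smooth map on a subset A of R^n is represented by a total function
     that is smooth on some open neighbourhood of A; only its values on A
     matter (and its derivatives on A, which those values determine when A is
     contained in the closure of its interior).
   - Objects on S^1 = R/2piZ are represented by 2pi-periodic objects on R. *)

Section Smooth.
Context {R : realType}.

Fixpoint Ck {V W : normedModType R} (k : nat) (U : set V) (f : V -> W) : Prop :=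
  match k with
  | 0 => forall x, U x -> {for x, continuous f}
  | k'.+1 => (forall x, U x -> differentiable f x) /\
             (forall v : V, Ck k' U (fun x => 'D_v f x))
  end.

Definition smooth {V W : normedModType R} (U : set V) (f : V -> W) : Prop :=
  forall k, Ck k U f.

Definition smooth_near {V W : normedModType R} (A : set V) (f : V -> W) : Prop :=
  exists U : set V, [/\ open U, A `<=` U & smooth U f].

Definition immersive {V W : normedModType R} (U : set V) (f : V -> W) : Prop :=
  forall x v, U x -> 'D_v f x = 0 -> v = 0.

Definition topological_embedding {V W : normedModType R} (A : set V)
    (f : V -> W) : Prop :=
  {within A, continuous f} /\
  exists g : W -> V, (forall x, A x -> g (f x) = x) /\
                     {within f @` A, continuous g}.

End Smooth.

Section Forms.
Context {R : realType}.

Definition dot n (u v : 'rV[R]_n) : R := \sum_i u 0 i * v 0 i.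

(* A 1-form on (a subset of) R^n is given by its coefficients
   A : 'rV[R]_n -> 'rV[R]_n, i.e. A_p(v) = dot (A p) v. *)
Definition pullback1 m n (f : 'rV[R]_m.+1 -> 'rV[R]_n.+1)
    (A : 'rV[R]_n.+1 -> 'rV[R]_n.+1) (p v : 'rV[R]_m.+1) : R :=
  dot (A (f p)) ('D_v f p).

Definition dform n (A : 'rV[R]_n.+1 -> 'rV[R]_n.+1) (p u v : 'rV[R]_n.+1) : R :=
  dot ('D_u A p) v - dot ('D_v A p) u.

(* (A /\ dA)_p (u, v, w) *)
Definition wedge_dform n (A : 'rV[R]_n.+1 -> 'rV[R]_n.+1)
    (p u v w : 'rV[R]_n.+1) : R :=
  dot (A p) u * dform A p v w + dot (A p) v * dform A p w u
  + dot (A p) w * dform A p u v.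

(* M is a 3-dimensional submanifold of R^(n+1), possibly with boundary,
   and T p its tangent space at p. *)
Definition contact_form n (M : set 'rV[R]_n.+1)
    (T : 'rV[R]_n.+1 -> set 'rV[R]_n.+1) (A : 'rV[R]_n.+1 -> 'rV[R]_n.+1) : Prop :=
  smooth_near M A /\
  forall p, M p -> exists u v w,
    [/\ T p u, T p v, T p w & wedge_dform A p u v w != 0].

End Forms.

Section Disc.
Context {R : realType}.

Definition disc : set 'rV[R]_2 := [set q | dot q q <= 1].
Definition int_disc : set 'rV[R]_2 := [set q | dot q q < 1].

(* 2r dr /\ dtheta = 2 dx /\ dy *)
Definition omega (u v : 'rV[R]_2) : R := 2 * (u 0 0 * v 0 1 - u 0 1 * v 0 0).

Definition inverse_on_disc (f g : 'rV[R]_2 -> 'rV[R]_2) : Prop :=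
  forall q, disc q -> [/\ disc (f q), disc (g q), f (g q) = q & g (f q) = q].

Definition area_preserving_diffeo (f : 'rV[R]_2 -> 'rV[R]_2) : Prop :=
  [/\ smooth_near disc f,
      exists g, inverse_on_disc f g /\ smooth_near disc g &
      forall q u v, disc q -> omega ('D_u f q) ('D_v f q) = omega u v].

End Disc.

Section SolidTorus.
Context {R : realType}.

Definition vec3 (a b c : R) : 'rV[R]_3 := \row_(i < 3) nth 0 [:: a; b; c] i.

(* Points of V = S^1 x D^2 are represented by (s, x, y) with
   x = r cos theta, y = r sin theta. *)
Definition solid (s : R) (q : 'rV[R]_2) : 'rV[R]_3 := vec3 s (q 0 0) (q 0 1).
Definition disc_part (p : 'rV[R]_3) : 'rV[R]_2 :=
  \row_(i < 2) nth 0 [:: p 0 1; p 0 2] i.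

Definition torusV : set 'rV[R]_3 := [set p | disc (disc_part p)].
Definition int_torusV : set 'rV[R]_3 := [set p | int_disc (disc_part p)].
Definition bd_torusV : set 'rV[R]_3 :=
  [set p | dot (disc_part p) (disc_part p) = 1].

Definition periodic_hamiltonian (H : 'rV[R]_3 -> R) : Prop :=
  smooth_near torusV H /\
  forall p, torusV p -> H (p + vec3 (2 * pi) 0 0) = H p.

(* psi is the time-2pi map of the isotopy Psi_s generated by X_s, where
   omega(X_s, .) = dH_s *)
Definition generated_by (H : 'rV[R]_3 -> R) (psi : 'rV[R]_2 -> 'rV[R]_2) : Prop :=
  exists (X : R -> 'rV[R]_2 -> 'rV[R]_2) (Psi : R -> 'rV[R]_2 -> 'rV[R]_2),
    (forall s q w, disc q -> omega (X s q) w = 'D_(solid 0 w) H (solid s q)) /\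
    (forall q, disc q ->
      [/\ Psi 0 q = q,
          forall s, disc (Psi s q),
          forall s, is_derive s (1 : R) (fun t => Psi t q) (X s (Psi s q)) &
          psi q = Psi (2 * pi) q]).

(* H_s ds + lambda, with lambda = r^2 dtheta = x dy - y dx *)
Definition alpha (H : 'rV[R]_3 -> R) (p : 'rV[R]_3) : 'rV[R]_3 :=
  vec3 (H p) (- p 0 2) (p 0 1).

End SolidTorus.

Section Sphere.
Context {R : realType}.

Definition sphere3 : set 'rV[R]_4 := [set p | dot p p = 1].
Definition tangent_sphere3 (p : 'rV[R]_4) : set 'rV[R]_4 := [set v | dot p v = 0].

Definition contact_sphere3 (A : 'rV[R]_4 -> 'rV[R]_4) : Prop :=
  contact_form sphere3 tangent_sphere3 A.

Definition reeb_field (A X : 'rV[R]_4 -> 'rV[R]_4) : Prop :=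
  forall p, sphere3 p ->
    [/\ tangent_sphere3 p (X p), dot (A p) (X p) = 1 &
        forall v, tangent_sphere3 p v -> dform A p (X p) v = 0].

Definition flow_of (X : 'rV[R]_4 -> 'rV[R]_4) (Fl : R -> 'rV[R]_4 -> 'rV[R]_4) : Prop :=
  forall p, sphere3 p ->
    [/\ Fl 0 p = p, forall t, sphere3 (Fl t p) &
        forall t, is_derive t (1 : R) (fun u => Fl u p) (X (Fl t p))].

(* F : U -> W is a diffeomorphism of open subsets of R^4 flattening the
   3-sphere to the hyperplane where the last coordinate vanishes, hence its
   first three components are a chart of the 3-sphere. *)
Definition sphere_chart (U : set 'rV[R]_4) (F : 'rV[R]_4 -> 'rV[R]_4) : Prop :=
  [/\ open U, open (F @` U), smooth U F,
      exists G, (forall x, U x -> G (F x) = x) /\ smooth (F @` U) G &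
      forall x, U x -> (sphere3 x <-> F x 0 3 = 0)].

Definition surface_interior (S : set 'rV[R]_4) : set 'rV[R]_4 :=
  [set p | S p /\ exists U F, [/\ U p, sphere_chart U F &
    forall x, U x -> (S x <-> F x 0 2 = 0 /\ F x 0 3 = 0)]].

Definition surface_boundary (S : set 'rV[R]_4) : set 'rV[R]_4 :=
  [set p | S p /\ exists U F, [/\ U p, sphere_chart U F, F p 0 0 = 0 &
    forall x, U x -> (S x <-> [/\ 0 <= F x 0 0, F x 0 2 = 0 & F x 0 3 = 0])]].

Definition embedded_compact_surface (S : set 'rV[R]_4) : Prop :=
  [/\ S `<=` sphere3, compact S &
      S `<=` surface_interior S `|` surface_boundary S].

(* Velocity vectors at p of curves in S; at interior points of an embedded
   surface this is its tangent plane. *)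
Definition tangent_vectors (S : set 'rV[R]_4) (p : 'rV[R]_4) : set 'rV[R]_4 :=
  [set v | exists c : R -> 'rV[R]_4,
    [/\ c 0 = p, \forall t \near (0 : R), S (c t) & is_derive (0 : R) (1 : R) c v]].

Definition global_surface_of_section (X : 'rV[R]_4 -> 'rV[R]_4)
    (Fl : R -> 'rV[R]_4 -> 'rV[R]_4) (S : set 'rV[R]_4) : Prop :=
  [/\ embedded_compact_surface S,
      forall p, surface_boundary S p -> exists T : R,
        [/\ 0 < T, Fl T p = p &
            connected_component (surface_boundary S) p = range (fun t => Fl t p)],
      forall p, surface_interior S p -> ~ tangent_vectors S p (X p) &
      forall p, sphere3 p -> ~ surface_boundary S p ->
        (exists2 t : R, 0 < t & surface_interior S (Fl t p)) /\
        (exists2 t : R, t < 0 & surface_interior S (Fl t p))].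

(* On int_disc, and under the parametrisation e of the surface e(disc), the
   first-return map of Fl is psi. *)
Definition has_return_map (Fl : R -> 'rV[R]_4 -> 'rV[R]_4)
    (e : 'rV[R]_2 -> 'rV[R]_4) (psi : 'rV[R]_2 -> 'rV[R]_2) : Prop :=
  forall q, int_disc q -> exists T : R,
    [/\ 0 < T,
        forall t, 0 < t < T -> ~ surface_interior (e @` disc) (Fl t (e q)),
        surface_interior (e @` disc) (Fl T (e q)) &
        Fl T (e q) = e (psi q)].

Definition realised_on (A : 'rV[R]_4 -> 'rV[R]_4) (e : 'rV[R]_2 -> 'rV[R]_4)
    (psi : 'rV[R]_2 -> 'rV[R]_2) : Prop :=
  exists X Fl, [/\ reeb_field A X, flow_of X Fl,
    global_surface_of_section X Fl (e @` disc) & has_return_map Fl e psi].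

Definition embeds_into_reeb_flow (psi : 'rV[R]_2 -> 'rV[R]_2) : Prop :=
  exists (A : 'rV[R]_4 -> 'rV[R]_4) (e : 'rV[R]_2 -> 'rV[R]_4),
    [/\ contact_sphere3 A,
        topological_embedding disc e,
        smooth int_disc e /\ immersive int_disc e &
        realised_on A e psi].

End Sphere.

Section Cut.
Context {R : realType}.

Definition same_point (p q : 'rV[R]_3) : Prop :=
  exists k : int, q = p + vec3 (2 * pi * k%:~R) 0 0.

(* Flow of Y = d/ds - h d/dtheta. *)
Definition flowY (h : nat) (t : R) (p : 'rV[R]_3) : 'rV[R]_3 :=
  vec3 (p 0 0 + t)
       (p 0 1 * cos (h%:R * t) + p 0 2 * sin (h%:R * t))
       (p 0 2 * cos (h%:R * t) - p 0 1 * sin (h%:R * t)).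

Definition cut_equiv (h : nat) (p q : 'rV[R]_3) : Prop :=
  same_point p q \/ (bd_torusV p /\ exists t, same_point (flowY h t p) q).

(* The arguments of tau are (r, s, theta), those of g are (tau, s, theta);
   the collar is 1 - delta < r <= 1. *)
Definition collar_parameter (delta eps : R) (tau g : 'rV[R]_3 -> R) : Prop :=
  let C := [set c : 'rV[R]_3 | 1 - delta < c 0 0 <= 1] in
  let E := [set c : 'rV[R]_3 | - eps < c 0 0 <= 0] in
  [/\ 0 < delta <= 1 /\ 0 < eps,
      smooth_near C tau /\ smooth_near E g,
      (forall c (k l : int), C c ->
         tau (c + vec3 0 (2 * pi * k%:~R) (2 * pi * l%:~R)) = tau c) /\
      (forall c (k l : int), E c ->
         g (c + vec3 0 (2 * pi * k%:~R) (2 * pi * l%:~R)) = g c),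
      forall s th, tau (vec3 1 s th) = 0 /\
        (forall r, 1 - delta < r < 1 -> tau (vec3 r s th) < 0) &
      forall s th,
        (forall r, 1 - delta < r <= 1 -> - eps < tau (vec3 r s th) ->
           g (vec3 (tau (vec3 r s th)) s th) = r) /\
        (forall t, - eps < t <= 0 ->
           1 - delta < g (vec3 t s th) <= 1 /\
           tau (vec3 (g (vec3 t s th)) s th) = t)].

(* Phi in the coordinates (b, rho, vartheta). *)
Definition Phi (h : nat) (g : 'rV[R]_3 -> R) (c : 'rV[R]_3) : 'rV[R]_3 :=
  let b := c 0 0 in let rho := c 0 1 in let vt := c 0 2 in
  let th := b - h%:R * vt in
  let r := g (vec3 (- rho ^+ 2) vt th) in
  vec3 vt (r * cos th) (r * sin th).

(* (b, rho, vartheta) |-> (b, rho cos vartheta, rho sin vartheta) *)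
Definition polar (c : 'rV[R]_3) : 'rV[R]_3 :=
  vec3 (c 0 0) (c 0 1 * cos (c 0 2)) (c 0 1 * sin (c 0 2)).

(* B x Int(D^2_{sqrt eps}), in Cartesian coordinates on the disc factor *)
Definition cut_chart_domain (eps : R) : set 'rV[R]_3 :=
  [set p | dot (disc_part p) (disc_part p) < eps].

(* Q : V -> S^3 induces a diffeomorphism from V/~, with the smooth structure
   defined by Int(V) and by Phi, onto the unit sphere. The map Psi is Q o Phi
   extended over B x {0}; on rho = 0 the condition on Psi says that (b, 0)
   corresponds to the class of the boundary points with theta + h s = b. *)
Definition cut_identification (h : nat) (eps : R) (g : 'rV[R]_3 -> R)
    (Q : 'rV[R]_3 -> 'rV[R]_4) : Prop :=
  [/\ {within torusV, continuous Q} /\ Q @` torusV = sphere3,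
      forall p q, torusV p -> torusV q -> (Q p = Q q <-> cut_equiv h p q),
      smooth int_torusV Q /\ immersive int_torusV Q &
      exists Psi : 'rV[R]_3 -> 'rV[R]_4,
        [/\ forall c : 'rV[R]_3, 0 <= c 0 1 -> c 0 1 ^+ 2 < eps ->
              Psi (polar c) = Q (Phi h g c),
            smooth (cut_chart_domain eps) Psi &
            immersive (cut_chart_domain eps) Psi]].

(* The equality of Phi^* alpha and beta away from rho = 0 is stated after
   pulling back by the covering map polar. *)
Definition extends_over_cut (h : nat) (eps : R) (g : 'rV[R]_3 -> R)
    (a : 'rV[R]_3 -> 'rV[R]_3) : Prop :=
  exists beta : 'rV[R]_3 -> 'rV[R]_3,
    contact_form (cut_chart_domain eps) (fun=> setT) beta /\
    forall c v : 'rV[R]_3, 0 < c 0 1 -> c 0 1 ^+ 2 < eps ->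
      pullback1 polar beta c v = pullback1 (Phi h g) a c v.

Definition embeds_by_cut_construction (H : 'rV[R]_3 -> R) (h : nat)
    (psi : 'rV[R]_2 -> 'rV[R]_2) : Prop :=
  contact_form torusV (fun=> setT) (alpha H) /\
  exists (delta eps : R) (tau g : 'rV[R]_3 -> R)
         (Q : 'rV[R]_3 -> 'rV[R]_4) (A : 'rV[R]_4 -> 'rV[R]_4),
    [/\ collar_parameter delta eps tau g,
        cut_identification h eps g Q,
        extends_over_cut h eps g (alpha H),
        contact_sphere3 A /\
        (forall p v, int_torusV p -> pullback1 Q A p v = dot (alpha H p) v) &
        realised_on A (fun q => Q (solid 0 q)) psi].

End Cut.

(* Main.v *)
(* The contact form on the sphere is kept and only the parametrisation of the
   surface of section changes, from e = Q (0, .) to e o phi: the image is the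
   same, and a return map psi read through e becomes phi^-1 o psi o phi read
   through e o phi. *)

Require Import Defs.
From HB Require Import structures.
From mathcomp Require Import all_boot all_order all_algebra.
From mathcomp Require Import all_classical all_reals all_analysis.
From mathcomp Require Import ring lra.

Set Implicit Arguments.
Unset Strict Implicit.
Unset Printing Implicit Defensive.

Import Order.TTheory GRing.Theory Num.Theory.
Import numFieldNormedType.Exports.

Local Open Scope classical_set_scope.
Local Open Scope ring_scope.

(** * Calculus of C^k maps between normed spaces *)

Section SmoothCalculus.
Context {R : realType}.
Implicit Types V W Z : normedModType R.

(** The first-order expansion of [f] at [x] is also one of [g], and uniqueness of the differential
    identifies its linear part with ['d g x]. *)
Lemma near_eq_differentiable V W (f g : V -> W) (x : V) :
  (\near x, f x = g x) -> differentiable f x -> differentiable g x.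
Proof.
move=> fg df; have [cdf /eqaddoP dfE] := (diff_locallyP _ _).1 df.
have gE : g \o shift x = cst (g x) + 'd f x +o_ 0 id.
  have hx : h + x @[h --> (0 : V)] --> x.
    rewrite -[X in _ --> X]add0r.
    by apply: cvgD; [exact: cvg_id|exact: cvg_cst].
  apply/eqaddoP => e e0; have := dfE e e0; have := hx _ fg.
  rewrite /= !near_simpl.
  apply: filterS2 => h /= fgh.
  by rewrite !fctE /= fgh (nbhs_singleton fg).
by apply/diff_locallyP; rewrite (diff_unique cdf gE).
Qed.

(** Openness of [U] turns pointwise equality into equality near each point, which passes to
    directional derivatives and keeps the induction going. *)
Lemma eq_Ck V W k (U : set V) (f g : V -> W) : open U ->
  (forall x, U x -> f x = g x) -> Ck k U f -> Ck k U g.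
Proof.
move=> oU; elim: k f g => [|k IH] f g fg /=.
  move=> cf x Ux; rewrite /prop_for /continuous_at -(fg x Ux).
  apply: cvg_trans (cf x Ux); apply: near_eq_cvg.
  by near=> y; apply/fg; near: y; exact: open_nbhs_nbhs.
have fgx x : U x -> \near x, f x = g x.
  by move=> Ux; near=> y; apply/fg; near: y; exact: open_nbhs_nbhs.
move=> [df Df]; split=> [x Ux|v].
  exact: near_eq_differentiable (fgx x Ux) (df x Ux).
by apply: IH (Df v) => x /fgx /near_eq_derive.
Unshelve. all: by end_near. Qed.

Lemma CkW V W k (U : set V) (f : V -> W) : Ck k.+1 U f -> Ck k U f.
Proof.
elim: k f => [|k IH] f [df Df].
  by move=> x /df /differentiable_continuous.
by split=> // v; exact: IH (Df v).
Qed.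

Lemma Ck_subset V W k (U U' : set V) (f : V -> W) :
  U `<=` U' -> Ck k U' f -> Ck k U f.
Proof.
move=> UU'; elim: k f => [|k IH] f; first by move=> cf x /UU'; exact: cf.
by move=> [df Df]; split=> [x /UU'/df //|v]; exact: IH (Df v).
Qed.

Lemma Ck_cst V W k (U : set V) (a : W) : Ck k U (fun=> a).
Proof.
elim: k a => [|k IH] a /=; first by move=> x _; exact: cst_continuous.
split=> [x _|v]; first exact: differentiable_cst.
by under eq_fun do rewrite derive_cst; exact: IH.
Qed.

Lemma CkD V W k (U : set V) (f g : V -> W) : open U ->
  Ck k U f -> Ck k U g -> Ck k U (f \+ g).
Proof.
move=> oU; elim: k f g => [|k IH] f g /=.
  by move=> cf cg x Ux; apply: continuousD; [exact: cf|exact: cg].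
move=> [df Df] [dg Dg]; split=> [x Ux|v].
  by apply: differentiableD; [exact: df|exact: dg].
apply: eq_Ck (IH _ _ (Df v) (Dg v)) => // x Ux /=.
by rewrite deriveD //; apply: diff_derivable; [exact: df|exact: dg].
Qed.

Lemma Ck_sum V W k (U : set V) n (f : 'I_n -> V -> W) : open U ->
  (forall i, Ck k U (f i)) -> Ck k U (fun x => \sum_(i < n) f i x).
Proof.
move=> oU; elim: n f => [|n IH] f Cf.
  by under eq_fun do rewrite big_ord0; exact: Ck_cst.
under eq_fun do rewrite big_ord_recl.
by apply: CkD => //; exact: IH.
Qed.

Lemma scaler_is_bilinear W :
  bilinear_for
    (GRing.Scale.Law.clone _ _ *:%R _) (GRing.Scale.Law.clone _ _ *:%R _)
    (@GRing.scale R W).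
Proof.
split=> [u'|u] a x y /=; first by rewrite scalerDl scalerA.
by rewrite scalerDr !scalerA mulrC.
Qed.

(** Scaling is a continuous bilinear map, so its differential is the product-rule expression. *)
Lemma is_diff_scale W (p : R * W) :
  is_diff p (fun q : R * W => q.1 *: q.2) (fun q => p.1 *: q.2 + q.1 *: p.2).
Proof.
pose bM := bilinear_isBilinear.Build R R W W _ _ (@GRing.scale R W)
  (scaler_is_bilinear W).
pose b : {bilinear R -> W -> W} := HB.pack (@GRing.scale R W) bM.
have cb : continuous (fun q : R * W => b q.1 q.2).
  by move=> q; exact: scale_continuous.
apply: DiffDef; first exact: (differentiable_bilin p cb).
exact: (diff_bilin p cb).
Qed.

Lemma is_diffZ_fun V W (a da : V -> R) (f df : V -> W) x :
  is_diff x a da -> is_diff x f df ->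
  is_diff x (fun y => a y *: f y) (fun v => a x *: df v + da v *: f x).
Proof.
move=> dax dfx.
have /= := is_diff_comp (is_diff_pair dax dfx) (is_diff_scale (a x, f x)).
exact.
Qed.

Lemma CkZ V W k (U : set V) (a : V -> R) (f : V -> W) : open U ->
  Ck k U a -> Ck k U f -> Ck k U (fun x => a x *: f x).
Proof.
move=> oU; elim: k a f => [|k IH] a f.
  by move=> ca cf x Ux; apply: continuousZ; [exact: ca|exact: cf].
(* The Leibniz rule leaves one factor undifferentiated in each term, so both maps are also needed at
   order [k]. *)
move=> /[dup] /CkW Ca [da Da] /[dup] /CkW Cf [df Df].
have D x : U x -> is_diff x (fun y => a y *: f y)
    (fun v => a x *: 'd f x v + 'd a x v *: f x).
  move=> Ux; apply: is_diffZ_fun; apply: differentiableP; [exact: da|exact: df].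
split=> [x /D []//|v].
apply: eq_Ck (CkD oU (IH _ _ Ca (Df v)) (IH _ _ (Da v) Cf)) => // x Ux /=.
have dax := da x Ux; have dfx := df x Ux.
by have [dZ eZ] := D x Ux; rewrite !deriveE // eZ.
Qed.

Lemma differentiable_coord_comp V n (f : V -> 'rV[R]_n) i x :
  differentiable f x -> differentiable (fun y => f y 0 i) x.
Proof.
move=> df; exact: (differentiable_comp (g := fun M : 'rV[R]_n => M 0 i) df
  (differentiable_coord _ 0 i)).
Qed.

Lemma derive_coord V n (f : V -> 'rV[R]_n) i x v :
  differentiable f x -> 'D_v (fun y => f y 0 i) x = ('D_v f x) 0 i.
Proof. by move=> df; rewrite derive_mx ?mxE //; exact: diff_derivable. Qed.

Lemma Ck_coord V k (U : set V) n (f : V -> 'rV[R]_n) (i : 'I_n) : open U ->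
  Ck k U f -> Ck k U (fun x => f x 0 i).
Proof.
move=> oU; elim: k f => [|k IH] f.
  move=> cf x Ux.
  apply: (continuous_comp (g := fun M : 'rV[R]_n => M 0 i) (cf x Ux)).
  exact: coord_continuous.
move=> [df Df]; split=> [x Ux|v]; first exact/differentiable_coord_comp/df.
by apply: eq_Ck (IH _ (Df v)) => // x Ux /=; exact/esym/derive_coord/df.
Qed.

Lemma derive_comp V W Z (f : W -> Z) (g : V -> W) x v :
  differentiable g x -> differentiable f (g x) ->
  'D_v (f \o g) x = 'D_('D_v g x) f (g x).
Proof.
move=> dg df; have dfg := differentiable_comp dg df.
by rewrite (deriveE _ dfg) (deriveE _ df) (deriveE _ dg) diff_comp.
Qed.

(** In the chain rule the direction ['D_v g x] varies with [x], while [Ck] speaks of fixed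
    directions only. Expanding it in the standard basis of the middle space ['rV[R]_n] gives a
    finite sum of C^k products. *)
Lemma Ck_comp V W k (U : set V) n (U' : set 'rV[R]_n)
    (f : 'rV[R]_n -> W) (g : V -> 'rV[R]_n) : open U ->
  (forall x, U x -> U' (g x)) -> Ck k U' f -> Ck k U g -> Ck k U (f \o g).
Proof.
move=> oU UU'; elim: k f => [|k IH] f.
  move=> cf cg x Ux.
  exact: (continuous_comp (cg x Ux) (cf _ (UU' x Ux))).
move=> [df Df] /[dup] /CkW Cg [dg Dg]; split=> [x Ux|v].
  exact: differentiable_comp (dg x Ux) (df _ (UU' x Ux)).
have CS : Ck k U (fun x => \sum_(i < n)
    ('D_v g x) 0 i *: ('D_(delta_mx 0 i) f \o g) x).
  apply: Ck_sum => // i; apply: CkZ => //; first exact: (Ck_coord i oU (Dg v)).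
  exact: IH (Df _) Cg.
apply: eq_Ck CS => // x Ux /=.
have dfx := df _ (UU' _ Ux).
rewrite (derive_comp _ (dg x Ux) dfx) (deriveE _ dfx).
rewrite [in RHS](row_sum_delta ('D_v g x)) linear_sum; apply: eq_bigr => i _.
by rewrite linearZ /= (deriveE _ dfx).
Qed.

(** Fermat's criterion for the one-variable function [F \o L] along the line [L] through [x] with
    velocity [v]. *)
Lemma derive_local_max V (F : V -> R) x v :
  (\forall y \near x, differentiable F y) -> (\forall y \near x, F y <= F x) ->
  'D_v F x = 0.
Proof.
move=> dF maxF; pose L t : V := t *: v + x.
have dL t : differentiable L t.
  by apply: differentiableD;
    [exact: differentiableZl|exact: differentiable_cst].
have L0 : L 0 = x by rewrite /L scale0r add0r.
have DL : 'D_1 L 0 = v.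
  have dv : derivable (fun t : R => t *: v) 0 1.
    exact/diff_derivable/differentiableZl.
  rewrite deriveD // derive_cst addr0 deriveE; last exact: differentiableZl.
  by rewrite diffZl // diff_val scale1r.
have cL : L t @[t --> (0 : R)] --> x.
  by rewrite -[X in _ --> X]L0; exact: differentiable_continuous.
have [d /= d0 dP] :
    \forall t \near (0 : R), differentiable F (L t) /\ F (L t) <= F x.
  by apply: (cL (fun y => differentiable F y /\ F y <= F x)); exact: filterI.
have {}dP t : t \in `]-d, d[ -> differentiable F (L t) /\ F (L t) <= F x.
  by rewrite in_itv /= => td; apply: dP; rewrite /= sub0r normrN ltr_norml.
have dFL t : t \in `]-d, d[ -> derivable (F \o L) t 1.
  by move=> /dP [dFt _]; exact/diff_derivable/differentiable_comp.
have d00 : 0 \in `]-d, d[ by rewrite in_itv /= oppr_lt0 d0.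
have [] := @derive1_at_max R (F \o L) (- d) d 0 _ dFL d00.
- by rewrite ge0_cp // ltW.
- by move=> t /dP [_]; rewrite /= L0.
- by move=> _; rewrite (@derive_comp _ _ _ F L) ?L0 ?DL //;
  exact: (nbhs_singleton dF).
Qed.

End SmoothCalculus.

(** * Embeddings of compact sets *)

Section Topology.
Context {R : realType}.

Lemma within_continuous_comp_sub {T U Z : topologicalType} (A : set T)
    (B : set U) (f : T -> U) (g : U -> Z) :
  (forall x, A x -> B (f x)) ->
  {within A, continuous f} -> {within B, continuous g} ->
  {within A, continuous (g \o f)}.
Proof.
move=> AB /subspace_continuousP cf /subspace_continuousP cg.
apply/subspace_continuousP => x Ax P /(cg _ (AB _ Ax)) /= /(cf _ Ax) /=.
rewrite !nbhs_filterE /within /= => fP; apply: filterS fP => y BP Ay.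
exact: (BP Ay (AB _ Ay)).
Qed.

(** A continuous injection of a compact set into a Hausdorff space is closed onto its image, so its
    inverse is continuous. *)
Lemma compact_injective_embedding {V W : normedModType R} (A : set V)
    (f : V -> W) : compact A -> {within A, continuous f} ->
  (forall x y, A x -> A y -> f x = f y -> x = y) ->
  topological_embedding A f.
Proof.
move=> cA cf inj; split=> //.
(* Off the image of [A] the default 0 is returned; only values on the image matter. *)
pose g y := xget 0 [set x | A x /\ f x = y].
have gf x : A x -> g (f x) = x.
  move=> Ax; rewrite /g; case: xgetP => [y _ [Ay fyx]|/(_ x)]; first exact: inj.
  by case.
exists g; split=> //; apply/continuous_closedP => C cC.
(* On the image of [A], the preimage of [C] under [g] is the image of a compact set, hence
   closed. *)
apply/closed_subspaceP; exists (f @` (A `&` C)).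
  apply: compact_closed; first exact: norm_hausdorff.
  apply: continuous_compact; last exact: compact_closedI.
  by apply: continuous_subspaceW cf; exact: subIsetl.
apply/seteqP; split=> y [].
  move=> [x [Ax Cx] <-] _; split; last by exists x.
  by suff: C (g (f x)) by []; rewrite gf.
move=> /[swap] -[x Ax <-] Cx; split; last by exists x.
by exists x => //; split=> //; rewrite -(gf x Ax).
Qed.

End Topology.

(** * The closed and open unit discs *)

Section DiscGeometry.
Context {R : realType}.
Implicit Types (q u v w : 'rV[R]_2).

Lemma dot2E u v : dot u v = u 0 0 * v 0 0 + u 0 1 * v 0 1.
Proof.
rewrite /dot !big_ord_recl big_ord0 addr0 (_ : lift ord0 ord0 = 1) //.
exact/val_inj.
Qed.

Lemma row2P u v : u 0 0 = v 0 0 -> u 0 1 = v 0 1 -> u = v.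
Proof.
move=> e0 e1; apply/rowP => -[[|[|//]] i].
  by rewrite (_ : Ordinal i = 0) //; exact/val_inj.
by rewrite (_ : Ordinal i = 1) //; exact/val_inj.
Qed.

Lemma dot_self_continuous : continuous (fun q => dot q q).
Proof.
rewrite (_ : (fun q => _) = fun q => q 0 0 * q 0 0 + q 0 1 * q 0 1); last first.
  by apply/funext => q; exact: dot2E.
move=> q; have c i : {for q, continuous (fun p : 'rV[R]_2 => p 0 i)}.
  exact: coord_continuous.
have cc i : {for q, continuous (fun p : 'rV[R]_2 => p 0 i * p 0 i)}.
  exact: (continuousM (c i) (c i)).
exact: (continuousD (cc 0) (cc 1)).
Qed.

Lemma open_int_disc : open (@int_disc R).
Proof.
have /continuousP := dot_self_continuous.
by move=> /(_ _ (@open_lt R 1)).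
Qed.

Lemma compact_disc : compact (@disc R).
Proof.
apply: bounded_closed_compact; last first.
  have /continuous_closedP := dot_self_continuous.
  by move=> /(_ _ (@closed_le R 1)).
(* The round disc lies in the unit ball of the sup norm: each coordinate is at most 1 in absolute
   value. *)
exists 1; split=> // M M1 q; rewrite /disc /= dot2E => q1.
rewrite [leLHS]/Num.Def.normr /= mx_normrE; apply: bigmax_le.
  by rewrite ltW// (lt_trans _ M1).
move=> [i j] _ /=; apply: (le_trans _ (ltW M1)); rewrite (ord1 i) ler_norml.
have bnd (a b : R) : a * a + b * b <= 1 -> -1 <= a <= 1.
  move=> ab; have b0 := sqr_ge0 b; rewrite expr2 in b0; apply/andP; split; nra.
case: j => -[|[|//]] j0.
  by rewrite (_ : Ordinal j0 = 0) ?(bnd _ (q 0 1)) //; exact/val_inj.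
rewrite (_ : Ordinal j0 = 1) ?(bnd _ (q 0 0)) 1?addrC //; exact/val_inj.
Qed.

Lemma int_discW q : int_disc q -> disc q.
Proof. exact: ltW. Qed.

End DiscGeometry.

(** * Area-preserving diffeomorphisms of the disc *)

Section AreaPreserving.
Context {R : realType}.

Implicit Types (q u v w : 'rV[R]_2) (f : 'rV[R]_2 -> 'rV[R]_2).

Lemma smooth_near_differentiable f q : smooth_near disc f -> disc q ->
  differentiable f q.
Proof. by move=> [U [_ DU sf]] /DU; exact: (sf 1%N).1. Qed.

Lemma omega_nondegenerate v : (forall u, omega u v = 0) -> v = 0.
Proof.
move=> ov; have := ov (delta_mx 0 0); have := ov (delta_mx 0 1).
rewrite /omega !mxE /= => o1 o0; apply: row2P; rewrite mxE; lra.
Qed.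

(** Preservation of [omega] turns a vanishing derivative into [omega u v = 0] for every [u], and
    [omega] is nondegenerate. *)
Lemma area_preserving_derive_inj f q v : area_preserving_diffeo f -> disc q ->
  'D_v f q = 0 -> v = 0.
Proof.
move=> [_ _ of_] Dq Dv0; apply: omega_nondegenerate => u.
by rewrite -(of_ q u v Dq) Dv0 /omega !mxE !mulr0 subrr mulr0.
Qed.

(* An interior point mapped to the unit circle would be a maximum of |f|^2, so
   the image of Df there would be orthogonal to f, whereas det Df = 1. *)
Lemma area_preserving_int_disc f q : area_preserving_diffeo f -> int_disc q ->
  int_disc (f q).
Proof.
move=> [sf [g [fg _]] of_] Dq; have dq := int_discW Dq.
have df p : disc p -> differentiable f p by exact: smooth_near_differentiable.
rewrite /int_disc /= lt_neqAle; have [-> _ _ _] := fg q dq; rewrite andbT.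
apply/eqP => fq1.
have nD : \forall p \near q, disc p.
  have : \forall p \near q, int_disc p.
    exact: open_nbhs_nbhs (conj open_int_disc Dq).
  by apply: filterS => p; exact: int_discW.
(* This is |f|^2 in coordinates, ready for the product rule; near [q] it is at most 1, its value at
   [q]. *)
pose F := fun p => f p 0 0 * f p 0 0 + f p 0 1 * f p 0 1.
have orth v : f q 0 0 * ('D_v f q) 0 0 + f q 0 1 * ('D_v f q) 0 1 = 0.
  have : 'D_v F q = 0.
    apply: derive_local_max.
      near=> p; have dp : differentiable f p by apply: df; near: p.
      by apply: differentiableD; apply: differentiableM;
        exact: differentiable_coord_comp.
    near=> p; rewrite /F -!dot2E fq1; have [] // := fg p; near: p; exact: nD.
  have dv i : derivable (fun p => f p 0 i) q v.
    exact/diff_derivable/differentiable_coord_comp/df.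
  have dv2 i := derivableM (dv i) (dv i).
  rewrite /F (deriveD (dv2 0) (dv2 1)) !deriveM //.
  rewrite !derive_coord; [|exact: df..].
  by rewrite /GRing.scale /=; lra.
have := of_ q (delta_mx 0 0) (delta_mx 0 1) dq.
move: (orth (delta_mx 0 0)) (orth (delta_mx 0 1)) fq1.
rewrite dot2E /omega !mxE /=.
move: ('D_(delta_mx 0 0) f q) ('D_(delta_mx 0 1) f q) (f q 0 0) (f q 0 1) =>
  w z x y ow oz xy1 det.
have {}det : w 0 0 * z 0 1 - w 0 1 * z 0 0 = 1 by lra.
(* Cramer's rule: each coordinate of [f q] times the determinant is a combination of the two
   orthogonality relations. *)
have x0 : x = 0.
  rewrite -[x]mulr1 -det.
  transitivity
    ((x * w 0 0 + y * w 0 1) * z 0 1 - w 0 1 * (x * z 0 0 + y * z 0 1)).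
    ring.
  by rewrite ow oz mul0r mulr0 subrr.
have y0 : y = 0.
  rewrite -[y]mulr1 -det.
  transitivity
    (w 0 0 * (x * z 0 0 + y * z 0 1) - (x * w 0 0 + y * w 0 1) * z 0 0).
    ring.
  by rewrite ow oz mul0r mulr0 subrr.
by move: xy1; rewrite x0 y0 !mulr0 addr0 => /eqP; rewrite eq_sym oner_eq0.
Unshelve. all: by end_near. Qed.

End AreaPreserving.

(** * Slices of the solid torus *)

Section Solid.
Context {R : realType}.
Implicit Types (q : 'rV[R]_2) (V : normedModType R).

Lemma disc_part_solid s q : disc_part (solid s q) = q.
Proof. by apply: row2P; rewrite !mxE. Qed.

Lemma solid_inj s : injective (solid s : 'rV[R]_2 -> _).
Proof. by move=> q u /(congr1 disc_part); rewrite !disc_part_solid. Qed.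

(** The affine form reduces the regularity of slice maps to that of sums and scalar multiples. *)
Lemma solidE s q :
  solid s q = vec3 s 0 0 + (q 0 0 *: vec3 0 1 0 + q 0 1 *: vec3 0 0 1).
Proof.
apply/rowP => -[[|[|[|//]]] i]; rewrite !mxE /=.
- by rewrite !mulr0 !addr0.
- by rewrite mulr0 mulr1 addr0 add0r.
- by rewrite mulr0 mulr1 !add0r.
Qed.

Lemma Ck_solid V k (U : set V) s (f : V -> 'rV[R]_2) : open U ->
  Ck k U f -> Ck k U (fun x => solid s (f x)).
Proof.
move=> oU Cf; under eq_fun do rewrite solidE.
have Cc := Ck_coord _ oU Cf.
apply: (CkD oU (Ck_cst _ _ _)).
by apply: (CkD oU); apply: (CkZ oU (Cc _) (Ck_cst _ _ _)).
Qed.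

Lemma differentiable_solid V s (f : V -> 'rV[R]_2) x :
  differentiable f x -> differentiable (fun y => solid s (f y)) x.
Proof.
move=> df; under eq_fun do rewrite solidE.
apply: differentiableD; first exact: differentiable_cst.
by apply: differentiableD; apply: differentiableZl;
  exact: differentiable_coord_comp.
Qed.

(** The map [solid s] is affine with linear part [solid 0], so the height [s] disappears from the
    derivative. *)
Lemma derive_solid V s (f : V -> 'rV[R]_2) x v : differentiable f x ->
  'D_v (fun y => solid s (f y)) x = solid 0 ('D_v f x).
Proof.
move=> df; rewrite derive_mx; last exact/diff_derivable/differentiable_solid.
apply/rowP => -[[|[|[|//]]] i]; rewrite !mxE /=.
- under eq_fun do rewrite !mxE /=.
  exact: derive_cst.
- by under eq_fun do rewrite !mxE /=; exact: derive_coord.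
- by under eq_fun do rewrite !mxE /=; exact: derive_coord.
Qed.

End Solid.

(** * The slice s = 0 in the cut quotient *)

Section Reparametrisation.
Context {R : realType}.
Implicit Types (q : 'rV[R]_2).

Lemma cos_sin_2pi_int (k : int) :
  cos (2 * pi * k%:~R : R) = 1 /\ sin (2 * pi * k%:~R : R) = 0.
Proof.
have nat_case n : cos (2 * pi * n%:R : R) = 1 /\ sin (2 * pi * n%:R : R) = 0.
  rewrite (_ : 2 * pi * n%:R = 0 + pi *+ 2 *+ n).
    by rewrite (periodicn (@cosD2pi R)) (periodicn (@sinD2pi R)) cos0 sin0.
  by rewrite add0r -[RHS]mulr_natr [2 * pi]mulr_natl.
case: k => n; first exact: nat_case.
rewrite NegzE mulrNz mulrN cosN sinN.
by have [-> ->] := nat_case n.+1; rewrite oppr0.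
Qed.

(** An orbit of Y starting on the slice s = 0 returns to it, modulo 2 pi, only at times in 2 pi Z.
    As [h] is an integer, the disc factor has then made full turns, so no two points of the slice
    are identified. *)
Lemma cut_equiv_solid0 h q u : cut_equiv h (solid 0 q) (solid 0 u) -> q = u.
Proof.
have pi2 (k : int) : 2 * pi * k%:~R = 0 :> R -> k = 0.
  move=> /eqP; rewrite !mulf_eq0 pnatr_eq0 /= (gt_eqF (pi_gt0 R)) /=.
  by rewrite intr_eq0 => /eqP.
case=> [[k e]|[_ [t [k e]]]].
  have := congr1 (fun p : 'rV[R]_3 => p 0 0) e; rewrite !mxE /= add0r.
  move=> /esym/pi2 k0; apply: (@solid_inj R 0); rewrite e k0 mulr0.
  by apply/rowP => -[[|[|[|//]]] i]; rewrite !mxE /= addr0.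
have := congr1 (fun p : 'rV[R]_3 => p 0 0) e; rewrite !mxE /= add0r.
move=> /esym/eqP; rewrite addr_eq0 => /eqP tE.
have htE : h%:R * t = - (2 * pi * (h%:Z * k)%:~R) by rewrite tE intrM; ring.
have [c s] := cos_sin_2pi_int (h%:Z * k).
move: e; rewrite /flowY htE cosN sinN c s => e; apply: row2P.
  have := congr1 (fun p : 'rV[R]_3 => p 0 1) e; rewrite !mxE /=; lra.
have := congr1 (fun p : 'rV[R]_3 => p 0 2) e; rewrite !mxE /=; lra.
Qed.

End Reparametrisation.

(** * Conjugation as a change of parametrisation *)

Theorem proposition4p13 (R : realType) (psi phi phiinv : 'rV[R]_2 -> 'rV[R]_2)
    (H : 'rV[R]_3 -> R) (h : nat) :
  (0 < h)%N ->
  area_preserving_diffeo psi ->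
  periodic_hamiltonian H ->
  (forall p, bd_torusV p -> H p = h%:R) ->
  generated_by H psi ->
  embeds_by_cut_construction H h psi ->
  area_preserving_diffeo phi ->
  inverse_on_disc phi phiinv ->
  embeds_into_reeb_flow (phiinv \o psi \o phi).
Proof.
move=> _ [_ [psiinv [psi_inv _]] _] _ _ _ [_ [delta [eps [tau [g [Q [A]]]]]]].
move=> [_ [[cQ _] Qinj [sQ iQ] _] _ [cA _]].
move=> [X [Fl [reeb flow section return_psi]]].
move=> aphi phi_inv.
have [sphi _ _] := aphi.
have phiD q : disc q -> disc (phi q) by move=> /phi_inv [].
have phiI q : int_disc q -> int_disc (phi q) by exact: area_preserving_int_disc.
have dphi q : int_disc q -> differentiable phi q.
  by move=> /int_discW; exact: smooth_near_differentiable.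
have solidV (q : 'rV[R]_2) : disc q -> torusV (solid 0 q).
  by rewrite /torusV /= disc_part_solid.
have solidI (q : 'rV[R]_2) : int_disc q -> int_torusV (solid 0 q).
  by rewrite /int_torusV /= disc_part_solid.
pose sphi0 := fun q => solid 0 (phi q).
pose e := Q \o sphi0.
have Cphi k : Ck k int_disc phi.
  have [U [_ DU sU]] := sphi.
  by apply: Ck_subset (sU k) => q /int_discW; exact: DU.
have Csphi k : Ck k int_disc sphi0.
  by apply: Ck_solid => //; exact: open_int_disc.
(* The surface is unchanged because [phi] maps the disc onto itself, with [phiinv] supplying
   preimages. *)
have imE : e @` disc = (fun q => Q (solid 0 q)) @` disc.
  apply/seteqP; split=> _ [q Dq <-]; first by exists (phi q) => //; exact: phiD.
  have [_ Dq' qE _] := phi_inv q Dq.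
  by exists (phiinv q) => //; rewrite /e /sphi0 /= qE.
exists A, e; split=> //.
- apply: compact_injective_embedding; first exact: compact_disc.
    apply: (@within_continuous_comp_sub _ _ _ _ torusV) => //.
      by move=> q /phiD /solidV.
    apply/subspace_continuousP => q Dq; apply: cvg_within_filter.
    apply: differentiable_continuous; apply: differentiable_solid.
    exact: smooth_near_differentiable.
  (* Equal images under [Q] mean cut-equivalent points, which coincide on the slice s = 0; then
     [phiinv] recovers [q = u]. *)
  move=> q u Dq Du eqe.
  have /cut_equiv_solid0 phiE : cut_equiv h (solid 0 (phi q)) (solid 0 (phi u)).
    by apply/Qinj => //; exact/solidV/phiD.
  by have [_ _ _ <-] := phi_inv q Dq; rewrite phiE; have [] := phi_inv u Du.
- split=> [k|q v Dq].
    (* Smoothness of [Q] is given over the open solid torus, so [phi] must keep the open disc inside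
       itself. *)
    apply: (@Ck_comp _ _ _ _ _ _ int_torusV) => //; first exact: open_int_disc.
    by move=> q /phiI /solidI.
  (* If the derivative of [e] kills [v], the chain rule and immersivity of [Q] give
     [solid 0 ('D_v phi q) = 0]; hence ['D_v phi q = 0], and area preservation gives [v = 0]. *)
  have dQ : differentiable Q (sphi0 q) by exact/(sQ 1%N).1/solidI/phiI.
  rewrite /e (derive_comp _ _ dQ); last exact/differentiable_solid/dphi.
  rewrite derive_solid; last exact: dphi.
  move=> /iQ - /(_ (solidI _ (phiI _ Dq))) s0.
  apply: (area_preserving_derive_inj aphi (int_discW Dq)).
  by rewrite -[LHS](disc_part_solid 0) s0; apply: row2P; rewrite !mxE.
- exists X, Fl; split=> //; first by rewrite imE.
  (* The return time for [e] at [q] is that of the original parametrisation at [phi q]. *)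
  move=> q Dq; have [T [T0 notS inS FlT]] := return_psi _ (phiI q Dq).
  exists T; rewrite imE; split=> //; rewrite FlT /e /sphi0 /=.
  (* Since [psi (phi q)] lies in the disc, [phi] undoes [phiinv] there. *)
  have [Dpsi _ _ _] := psi_inv _ (int_discW (phiI q Dq)).
  by have [_ _ -> _] := phi_inv _ Dpsi.
Qed.
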